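(* Let $M$ be a smooth manifold of dimension $2n+r$, let $L\subset\mathbb{T}_{\mathbb{C}}M$ be a lagrangian subbundle, and let $m\in M$ be a point at which the real index of $L$ is $r$, the order of $L$ is $s$ and the type of $L$ is $k$. Then there exist a complement $N$ of $\Delta_m$ in $T_mM$ and a real two-form $B\in\wedge^2T^*_mM$ such that, at the point $m$ and under the identification $T_mM=\Delta_m\oplus N$, $$L_m\cong e^{B}(L_{i\omega_\Delta}\times L_{(C,J)}),$$ where $L_{i\omega_\Delta}$ is the lagrangian subspace associated to the two-form $\omega_\Delta\in\wedge^2\Delta_m^*$, and $L_{(C,J)}$ is the lagrangian subspace associated to a (linear) almost CR structure $(C,J)$ on $N$.
   Context: $\mathbb{T}M:=TM\oplus T^*M$ has the pairing $\langle X+\xi,Y+\eta\rangle=\frac12(\eta(X)+\xi(Y))$, and $\mathbb{T}_{\mathbb{C}}M$ is its complexification. A lagrangian subbundle $L\subset\mathbb{T}_{\mathbb{C}}M$ is a smooth complex subbundle with $L=L^\perp$. For a conjugation-invariant complex subspace $F$, $\mathrm{Re}\,F$ is its set of real elements. Set $E:=\mathrm{pr}_{T_{\mathbb{C}}M}L$, and let $\varepsilon$ be the pointwise skew form on $E$ with $\varepsilon(X,Y)=\xi(Y)$ for $X+\xi\in L$, $Y\in E$. Set $\Delta:=\mathrm{Re}(E\cap\overline{E})$, $D:=\mathrm{Re}(E+\overline{E})$, $\omega_\Delta:=\mathrm{Im}(\varepsilon|_\Delta)\in\wedge^2\Delta^*$. Invariants: real index $=\mathrm{rank}(L\cap\overline{L})$;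 order $=\dim M-\mathrm{rank}\,D$; type $=\frac12(\mathrm{rank}\,D-\mathrm{rank}\,\Delta)$. For a real vector space $V$ with a two-form $\omega$, $L_{i\omega}=\{X+i\,\imath_X\omega\mid X\in V_{\mathbb{C}}\}\subset(V\oplus V^* )_{\mathbb{C}}$. A linear almost CR structure $(C,J)$ on $N$ is a subspace $C\subseteq N$ with $J\in\mathrm{End}(C)$, $J^2=-\mathrm{Id}$; with $C_{1,0}:=\ker(J-i\,\mathrm{Id})\subset C_{\mathbb{C}}$, $L_{(C,J)}:=C_{1,0}\oplus\mathrm{Ann}\,C_{1,0}\subset(N\oplus N^* )_{\mathbb{C}}$. The product $L_1\times L_2$ is the direct sum inside $((V_1\oplus V_2)\oplus(V_1\oplus V_2)^* )_{\mathbb{C}}$, and $e^B(X+\xi)=X+\xi+\imath_XB$. *)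

(* Defs.v *)
From HB Require Import structures.
From mathcomp Require Import all_boot all_order all_algebra ring complex.
From mathcomp Require Import all_classical all_reals all_analysis.

Set Implicit Arguments.
Unset Strict Implicit.
Unset Printing Implicit Defensive.

Import Order.TTheory GRing.Theory Num.Theory.
Import numFieldNormedType.Exports.

Local Open Scope classical_set_scope.
Local Open Scope ring_scope.
Local Open Scope complex_scope.

(* [Cplx x y] stands for [x + i y]. *)
Record cplx (V : Type) := Cplx { cre : V; cim : V }.

Section ComplexificationStructure.
Import VectorInternalTheory.
Context {R : rcfType}.

Lemma cplx_pairK (V : Type) :
  cancel (fun u : cplx V => (cre u, cim u)) (fun p => Cplx p.1 p.2).
Proof. by case. Qed.

HB.instance Definition _ (V : choiceType) :=
  Choice.copy (cplx V) (can_type (@cplx_pairK V)).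

Section Module.
Context (V : lmodType R).
Implicit Types (u v w : cplx V) (a b : R[i]).

Definition cplx_add u v := Cplx (cre u + cre v) (cim u + cim v).
Definition cplx_opp u := Cplx (- cre u) (- cim u).
Definition cplx_scale a u :=
  let: p +i* q := a in
  Cplx (p *: cre u - q *: cim u) (p *: cim u + q *: cre u).

Fact cplx_addA : associative cplx_add.
Proof. by move=> u v w; congr Cplx; rewrite /= addrA. Qed.
Fact cplx_addC : commutative cplx_add.
Proof. by move=> u v; congr Cplx; rewrite /= addrC. Qed.
Fact cplx_add0 : left_id (Cplx 0 0) cplx_add.
Proof. by case=> x y; rewrite /cplx_add /= !add0r. Qed.
Fact cplx_addN : left_inverse (Cplx 0 0) cplx_opp cplx_add.
Proof. by move=> u; rewrite /cplx_add /= !addNr. Qed.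

HB.instance Definition _ := GRing.isZmodule.Build (cplx V)
  cplx_addA cplx_addC cplx_add0 cplx_addN.

Fact cplx_scaleA a b u : cplx_scale a (cplx_scale b u) = cplx_scale (a * b) u.
Proof.
case: a b u => [p q] [s t] [x y]; congr Cplx => /=.
  rewrite !scalerBr !scalerDr !scalerA scalerBl scalerDl !opprD !addrA.
  by rewrite [LHS](AC 4%AC (1*4*2*3)%AC).
rewrite !scalerBr !scalerDr !scalerA scalerBl scalerDl !addrA.
by rewrite [LHS](AC 4%AC (1*4*2*3)%AC).
Qed.
Fact cplx_scale1 : left_id 1 cplx_scale.
Proof. by case=> x y; congr Cplx; rewrite /= scale1r scale0r ?subr0 ?addr0. Qed.
Fact cplx_scaleDr : right_distributive cplx_scale +%R.
Proof.
case=> [p q] [x y] [z t]; congr Cplx => /=.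
  by rewrite !scalerDr opprD addrACA.
by rewrite !scalerDr addrACA.
Qed.
Fact cplx_scaleDl u : {morph cplx_scale^~ u : a b / a + b}.
Proof.
case: u => [x y] [p q] [s t]; congr Cplx => /=.
  by rewrite !scalerDl opprD addrACA.
by rewrite !scalerDl addrACA.
Qed.

HB.instance Definition _ := GRing.Zmodule_isLmodule.Build R[i] (cplx V)
  cplx_scaleA cplx_scale1 cplx_scaleDr cplx_scaleDl.

End Module.

Fact cplx_vect_iso (V : vectType R) : Vector.axiom (dim V) (cplx V).
Proof.
exists (fun u : cplx V =>
    \row_(j < dim V) (v2r (cre u) 0 j +i*
                      v2r (cim u) 0 j)).
  case=> [p q] [x y] [z t]; apply/rowP => j; rewrite !mxE /=.
  rewrite !linearD !linearN !linearZ !mxE /=.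
  by apply/eqP; rewrite eq_complex /= mulrN !eqxx.
pose g (v : 'rV[R[i]]_(dim V)) : cplx V :=
  Cplx (r2v (\row_(j < dim V) complex.Re (v 0 j)))
       (r2v (\row_(j < dim V) complex.Im (v 0 j))).
apply: (@Bijective _ _ _ g).
  case=> x y; congr Cplx; apply: (canLR (@v2rK _ _));
  by apply/rowP => j; rewrite !mxE.
move=> v; apply/rowP => j; rewrite mxE /= !r2vK !mxE.
by case: (v 0 j).
Qed.

HB.instance Definition _ (V : vectType R) :=
  Lmodule_hasFinDim.Build R[i] (cplx V) (cplx_vect_iso V).

End ComplexificationStructure.

Section ComplexificationMaps.
Context {R : rcfType}.

(* The complex-linear extension of a real-linear map. *)
Definition cmap (V W : Type) (f : V -> W) (u : cplx V) : cplx W :=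
  Cplx (f (cre u)) (f (cim u)).

Fact cmap_is_linear (V W : lmodType R) (f : {linear V -> W}) :
  linear (cmap f : cplx V -> cplx W).
Proof.
case=> [p q] [x y] [z t]; congr Cplx => /=.
  by rewrite linearD linearB !linearZ.
by rewrite !linearD !linearZ.
Qed.
HB.instance Definition _ (V W : lmodType R) (f : {linear V -> W}) :=
  GRing.isLinear.Build R[i] (cplx V) (cplx W) _ (cmap f) (cmap_is_linear f).

(* The complex-bilinear extension of a real-bilinear map. *)
Definition cbil (V W : Type) (b : V -> W -> R) (u : cplx V) (v : cplx W) :
    R[i] :=
  (b (cre u) (cre v) - b (cim u) (cim v)) +i*
  (b (cre u) (cim v) + b (cim u) (cre v)).

Definition creal (V : lmodType R) (x : V) : cplx V := Cplx x 0.

Definition cconj (V : lmodType R) (u : cplx V) : cplx V :=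
  Cplx (cre u) (- cim u).

End ComplexificationMaps.

Section SpanSet.
Context {K : fieldType} {W : vectType K}.

(* The linear span of an arbitrary set of vectors. *)
Definition span_set (A : set W) : {vspace W} :=
  xget 0%VS [set U : {vspace W} | A `<=` [set x | x \in U] /\
    forall U' : {vspace W}, A `<=` [set x | x \in U'] -> (U <= U')%VS].

Lemma span_setP (A : set W) : A `<=` [set x | x \in span_set A] /\
  forall U : {vspace W}, A `<=` [set x | x \in U] -> (span_set A <= U)%VS.
Proof.
suff: exists U : {vspace W}, A `<=` [set x | x \in U] /\
    forall U' : {vspace W}, A `<=` [set x | x \in U'] -> (U <= U')%VS.
  by move/(xgetPex 0%VS).
pose P n := `[<exists2 U : {vspace W}, A `<=` [set x | x \in U] & \dim U = n>].
have exP : exists n, P n.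
  by exists (\dim {:W}); apply/asboolP; exists fullv => // x _; exact: memvf.
case: (ex_minnP exP) => n /asboolP[U AU dU] minn; exists U; split=> // U' AU'.
suff /eqP <- : (U :&: U' == U)%VS by exact: capvSr.
rewrite eqEdim capvSl dU minn//; apply/asboolP; exists (U :&: U')%VS => // x Ax.
by rewrite /= memv_cap AU ?AU'.
Qed.

Lemma mem_span_set (A : set W) (x : W) :
  A 0 -> (forall a u v, A u -> A v -> A (a *: u + v)) ->
  x \in span_set A <-> A x.
Proof.
move=> A0 Alin; have [sA minA] := span_setP A; split=> [|/sA//].
have AB (X : seq W) : (forall y, y \in X -> A y) -> forall y, y \in <<X>>%VS -> A y.
  move=> AX y /(coord_span (X := in_tuple X)) ->.
  elim/big_rec: _ => // i z _ Az; apply: Alin => //; apply: AX.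
  exact: mem_nth.
pose P n := `[<exists2 U : {vspace W}, [set y | y \in U] `<=` A & \dim U = n>].
have exP : exists n, P n.
  exists 0%N; apply/asboolP; exists 0%VS; last by rewrite dimv0.
  by move=> y /=; rewrite memv0 => /eqP->.
have ubP n : P n -> (n <= \dim {:W})%N.
  by move=> /asboolP[U _ <-]; exact: dimvS (subvf _).
case: (ex_maxnP exP ubP) => n /asboolP[U UA dU] maxn.
suff AU : A `<=` [set y | y \in U] by move/(subvP (minA U AU)); exact: UA.
move=> y Ay /=.
have : P (\dim (U + <[y]>)%VS).
  apply/asboolP; exists (U + <[y]>)%VS => // z /= /memv_addP[u uU [v]].
  by move=> /vlineP[a ->] ->; rewrite addrC; apply: Alin => //; exact: UA.
move/maxn; rewrite -dU => dUy.
have /eqP -> : (U == U + <[y]>)%VS by rewrite eqEdim addvSl.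
by apply: (subvP (addvSr _ _)); exact: memv_line.
Qed.

End SpanSet.

Section ConjRe.
Context {R : rcfType} {V : vectType R}.

Definition conjv (F : {vspace cplx V}) : {vspace cplx V} :=
  span_set [set cconj u | u in [set u | u \in F]].

Definition Rev (F : {vspace cplx V}) : {vspace V} :=
  span_set [set x | creal x \in F].

Lemma mem_conjv (F : {vspace cplx V}) u : u \in conjv F <-> cconj u \in F.
Proof.
have cK : involutive (@cconj R V) by case=> x y; rewrite /cconj /= opprK.
have imE v : [set cconj w | w in [set w | w \in F]] v <-> cconj v \in F.
  split=> [[w wF <-]|vF]; first by rewrite cK.
  by exists (cconj v); rewrite ?cK.
rewrite -imE; apply: mem_span_set.
  apply/imE; rewrite (_ : cconj _ = 0) ?mem0v//.
  by congr Cplx; rewrite /= oppr0.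
move=> [p q] v w /imE vF /imE wF; apply/imE.
have -> : cconj (p +i* q *: v + w) = (p -i* q) *: cconj v + cconj w.
  case: v w {vF wF} => [x y] [z t]; congr Cplx => /=.
    by rewrite scalerN scaleNr opprK.
  by rewrite !opprD scalerN scaleNr.
by rewrite memvD ?memvZ.
Qed.

Lemma mem_Rev (F : {vspace cplx V}) x : x \in Rev F <-> creal x \in F.
Proof.
apply: mem_span_set => /=; first exact: (mem0v F).
move=> a y z yF zF.
have -> : creal (a *: y + z) = a%:C *: creal y + creal z.
  by congr Cplx; rewrite /= !(scaler0, scale0r, subr0, addr0).
by rewrite memvD ?memvZ.
Qed.

End ConjRe.

Notation TT R V := (V * 'Hom(V, R^o))%type.

Section Lagrangian.
Context {R : rcfType} {V : vectType R}.

Definition pairing (u v : TT R V) : R := 2^-1 * (v.2 u.1 + u.2 v.1).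

Definition lagrangian (L : {vspace cplx (TT R V)}) : Prop :=
  forall u, u \in L <-> (forall v, v \in L -> cbil pairing u v = 0).

Definition ev (xi : cplx 'Hom(V, R^o)) (X : cplx V) : R[i] :=
  cbil (fun (f : 'Hom(V, R^o)) x => f x) xi X.

Definition range_sp (L : {vspace cplx (TT R V)}) : {vspace cplx V} :=
  (linfun (cmap (@fst V 'Hom(V, R^o))) @: L)%VS.

(* [range_sp L] is the space denoted [E = pr_T L]. *)
Definition Delta_sp (L : {vspace cplx (TT R V)}) : {vspace V} :=
  Rev (range_sp L :&: conjv (range_sp L)).

Definition D_sp (L : {vspace cplx (TT R V)}) : {vspace V} :=
  Rev (range_sp L + conjv (range_sp L)).

Definition real_index (L : {vspace cplx (TT R V)}) : nat :=
  \dim (L :&: conjv L).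

Definition lag_order (L : {vspace cplx (TT R V)}) : nat :=
  \dim {:V} - \dim (D_sp L).

(* The halving is exact: the difference of ranks is
   2 (\dim (range_sp L) - \dim (Delta_sp L)). *)
Definition lag_type (L : {vspace cplx (TT R V)}) : nat :=
  (\dim (D_sp L) - \dim (Delta_sp L))./2.

(* [xi(Y)] for a chosen [X + xi] in [L]; when [L] is lagrangian and [X], [Y]
   lie in [range_sp L], the value does not depend on the choice: see [epsE]. *)
Definition eps (L : {vspace cplx (TT R V)}) (X Y : cplx V) : R[i] :=
  ev (cmap snd (xget 0 [set u | u \in L /\ cmap fst u = X])) Y.

(* A two-form is encoded by [X |-> i_X omega]. *)
Definition two_form (W : vectType R) (b : 'Hom(W, 'Hom(W, R^o))) : Prop :=
  forall X, b X X = 0.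

Definition omega_Delta (L : {vspace cplx (TT R V)}) :
    'Hom(subvs_of (Delta_sp L), 'Hom(subvs_of (Delta_sp L), R^o)) :=
  linfun (fun X : subvs_of (Delta_sp L) =>
    linfun (fun Y : subvs_of (Delta_sp L) =>
      complex.Im (eps L (creal (vsval X)) (creal (vsval Y))) : R^o)).

Lemma range_spP (L : {vspace cplx (TT R V)}) X :
  reflect (exists2 u, u \in L & X = cmap fst u) (X \in range_sp L).
Proof.
apply: (iffP memv_imgP) => -[u uL ->]; exists u => //;
  by rewrite lfunE.
Qed.

Lemma cbil_pairing (u v : cplx (TT R V)) :
  cbil pairing u v =
  2^-1%:C * (ev (cmap snd v) (cmap fst u) + ev (cmap snd u) (cmap fst v)).
Proof.
rewrite /cbil /ev /cbil /pairing /=; apply/eqP; rewrite eq_complex /=.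
by apply/andP; split; apply/eqP; ring.
Qed.

Lemma ev_subl (xi eta : cplx 'Hom(V, R^o)) X :
  ev (xi - eta) X = ev xi X - ev eta X.
Proof.
rewrite /ev /cbil /= !(add_lfunE, opp_lfunE).
by apply/eqP; rewrite eq_complex /=; apply/andP; split; apply/eqP; ring.
Qed.

Lemma epsE (L : {vspace cplx (TT R V)}) u Y : lagrangian L ->
  u \in L -> Y \in range_sp L -> eps L (cmap fst u) Y = ev (cmap snd u) Y.
Proof.
move=> lagL uL /range_spP[v vL ->]; rewrite /eps.
have [] : [set w | w \in L /\ cmap fst w = cmap fst u]
    (xget 0 [set w | w \in L /\ cmap fst w = cmap fst u]).
  by apply: xgetPex; exists u.
set w := xget _ _ => wL wu.
have /(lagL _).1/(_ _ vL) : u - w \in L by rewrite memvB.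
have z1 : cmap fst (u - w) = 0.
  have -> : cmap fst (u - w) = cmap fst u - cmap fst w by [].
  by rewrite wu subrr.
have ev0 (xi : cplx 'Hom(V, R^o)) : ev xi 0 = 0.
  by rewrite /ev /cbil /= !linear0; congr Complex; exact: addr0.
rewrite cbil_pairing z1 ev0 add0r => /eqP; rewrite mulf_eq0 => /orP[|].
  by rewrite eq_complex /= eqxx andbT invr_eq0 pnatr_eq0.
have -> : cmap snd (u - w) = cmap snd u - cmap snd w by [].
by rewrite ev_subl subr_eq0 => /eqP.
Qed.

Lemma omega_DeltaE (L : {vspace cplx (TT R V)}) X Y : lagrangian L ->
  omega_Delta L X Y = complex.Im (eps L (creal (vsval X)) (creal (vsval Y))).
Proof.
move=> lagL.
have DE (Z : subvs_of (Delta_sp L)) : creal (vsval Z) \in range_sp L.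
  by have /mem_Rev := subvsP Z; rewrite memv_cap => /andP[].
have ImE xi (Z : V) : complex.Im (ev xi (creal Z)) = cim xi Z.
  by rewrite /= linear0 add0r.
pose g (Z : subvs_of (Delta_sp L)) : 'Hom(subvs_of (Delta_sp L), R^o) :=
  linfun (fun T : subvs_of (Delta_sp L) =>
    complex.Im (eps L (creal (vsval Z)) (creal (vsval T))) : R^o).
have gE Z T : g Z T = complex.Im (eps L (creal (vsval Z)) (creal (vsval T))).
  have lin : linear (fun T : subvs_of (Delta_sp L) =>
      complex.Im (eps L (creal (vsval Z)) (creal (vsval T))) : R^o).
    by move=> a x y; rewrite /eps !ImE !linearP.
  pose h := GRing.isLinear.Build _ _ _ _ _ lin.
  pose hl : {linear _ -> _} := HB.pack (fun T : subvs_of (Delta_sp L) =>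
      complex.Im (eps L (creal (vsval Z)) (creal (vsval T))) : R^o) h.
  exact: (lfunE hl).
have lin : linear g.
  move=> a x y; apply/lfunP => t; rewrite add_lfunE scale_lfunE !gE.
  have /range_spP[u uL xu] := DE x; have /range_spP[v vL yv] := DE y.
  have axy : creal (vsval (a *: x + y)) = cmap fst (a%:C *: u + v).
    have -> : cmap fst (a%:C *: u + v) = a%:C *: cmap fst u + cmap fst v by [].
    rewrite -xu -yv linearP; congr Cplx => /=.
      by rewrite scaler0 subr0.
    by rewrite scaler0 scale0r !addr0.
  rewrite axy xu yv !epsE ?memvD ?memvZ ?DE//.
  rewrite !ImE /= scale0r addr0 add_lfunE scale_lfunE; by [].
pose h := GRing.isLinear.Build _ _ _ _ _ lin.
pose hl : {linear _ -> _} := HB.pack g h.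
by rewrite -gE /omega_Delta -/g (lfunE hl).
Qed.

Lemma two_form_omega_Delta (L : {vspace cplx (TT R V)}) :
  lagrangian L -> two_form (omega_Delta L).
Proof.
move=> lagL X; rewrite omega_DeltaE//.
have XE : creal (vsval X) \in range_sp L.
  by have /mem_Rev := subvsP X; rewrite memv_cap => /andP[].
have /range_spP[u uL Xu] := XE; rewrite {1}Xu epsE// Xu.
have /eqP := (lagL u).1 uL _ uL.
rewrite cbil_pairing -mulr2n mulf_eq0 => /orP[|].
  by rewrite eq_complex /= eqxx andbT invr_eq0 pnatr_eq0.
by rewrite mulrn_eq0 orFb => /eqP ->.
Qed.

End Lagrangian.

Section Models.
Context {R : rcfType}.

Definition cpair (V W : Type) (X : cplx V) (xi : cplx W) : cplx (V * W) :=
  Cplx (cre X, cre xi) (cim X, cim xi).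

Definition L_i (V : vectType R) (omega : 'Hom(V, 'Hom(V, R^o))) :
    set (cplx (TT R V)) :=
  [set cpair X (('i : R[i]) *: (cmap omega X : cplx 'Hom(V, R^o)))
    | X in [set: cplx V]].

Definition almost_CR (N : vectType R) (C : {vspace N})
    (J : 'End(subvs_of C)) : Prop :=
  (J \o J = - \1)%VF.

(* [C_{1,0}], viewed in the complexification of [N]. *)
Definition C10 (N : vectType R) (C : {vspace N}) (J : 'End(subvs_of C)) :
    set (cplx N) :=
  [set cmap vsval X
    | X in [set X : cplx (subvs_of C) | cmap J X = ('i : R[i]) *: X]].

Definition Ann (N : vectType R) (S : set (cplx N)) :
    set (cplx 'Hom(N, R^o)) :=
  [set xi | forall X, S X -> ev xi X = 0].

Definition L_CR (N : vectType R) (C : {vspace N}) (J : 'End(subvs_of C)) :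
    set (cplx (TT R N)) :=
  [set cpair X xi | X in C10 J & xi in Ann (C10 J)].

Definition inT1 (V1 V2 : vectType R) (u : TT R V1) : TT R (V1 * V2)%type :=
  ((u.1, 0), (u.2 \o linfun (@fst V1 V2))%VF).

Definition inT2 (V1 V2 : vectType R) (u : TT R V2) : TT R (V1 * V2)%type :=
  ((0, u.1), (u.2 \o linfun (@snd V1 V2))%VF).

Definition L_prod (V1 V2 : vectType R) (L1 : set (cplx (TT R V1)))
    (L2 : set (cplx (TT R V2))) : set (cplx (TT R (V1 * V2)%type)) :=
  [set (cmap (@inT1 V1 V2) u1 : cplx (TT R (V1 * V2)%type)) +
       cmap (@inT2 V1 V2) u2 | u1 in L1 & u2 in L2].

(* Used for a linear isomorphism [Phi] only: [Phi^-1] is then its inverse. *)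
Definition TTmap (V W : vectType R) (Phi : 'Hom(V, W)) (u : TT R V) : TT R W :=
  (Phi u.1, (u.2 \o Phi^-1)%VF).

Definition sum_iso (V : vectType R) (D N : {vspace V}) :
    'Hom((subvs_of D * subvs_of N)%type, V) :=
  linfun (fun p : subvs_of D * subvs_of N => vsval p.1 + vsval p.2).

Definition expB (V : vectType R) (B : 'Hom(V, 'Hom(V, R^o))) (u : TT R V) :
    TT R V :=
  (u.1, u.2 + B u.1).

End Models.

Section Smooth.
Context {R : realType}.

Fixpoint Ck_on (V W : normedModType R) (k : nat) (A : set V) (f : V -> W) :
    Prop :=
  match k with
  | 0 => forall x, A x -> {for x, continuous f}
  | k'.+1 => (forall x, A x -> differentiable f x) /\
             (forall v, Ck_on k' A (fun x => 'D_v f x))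
  end.

Definition smooth_on (V W : normedModType R) (A : set V) (f : V -> W) : Prop :=
  forall k, Ck_on k A f.

Record chart (M : topologicalType) (d : nat) := Chart {
  chart_dom : set M;
  chart_fun :> M -> 'rV[R]_d;
  chart_inv : 'rV[R]_d -> M;
  chart_dom_open : open chart_dom;
  chart_img_open : open (chart_fun @` chart_dom);
  chart_funK : forall p, chart_dom p -> chart_inv (chart_fun p) = p;
  chart_continuous : {within chart_dom, continuous chart_fun};
  chart_inv_continuous :
    {within chart_fun @` chart_dom, continuous chart_inv}
}.

Record smooth_manifold (d : nat) := SmoothManifold {
  carrier :> topologicalType;
  carrier_hausdorff : hausdorff_space carrier;
  carrier_second_countable : @second_countable carrier;
  atlas : set (chart carrier d);
  chart_at : carrier -> chart carrier d;
  chart_at_atlas : forall p, atlas (chart_at p);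
  chart_at_dom : forall p, chart_dom (chart_at p) p;
  atlas_compatible : forall c c', atlas c -> atlas c' ->
    smooth_on (c @` (chart_dom c `&` chart_dom c')) (c' \o chart_inv c)
}.

(* Tangent vectors at [p] are represented by their components in the chart
   [chart_at p]; the components in another chart [c] are given by the
   differential of the transition map, see [vector_coord]. *)
Definition tangent (d : nat) (M : smooth_manifold d) (p : M) : vectType R :=
  'rV[R]_d.

Section Sections.
Context {d : nat} {M : smooth_manifold d}.

Definition vector_coord (c : chart M d) (p : M) (X : tangent p) : 'rV[R]_d :=
  'd (c \o chart_inv (chart_at p)) (chart_at p p) (X : 'rV[R]_d).

Definition covector_coord (c : chart M d) (p : M)
    (xi : 'Hom(tangent p, R^o)) : 'rV[R]_d :=
  \row_j xi ('d (chart_at p \o chart_inv c) (c p) (delta_mx 0 j : 'rV[R]_d)).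

Definition smooth_section (U : set M) (e : forall p : M, TT R (tangent p)) :
    Prop :=
  forall c, @atlas d M c ->
    smooth_on (c @` (U `&` chart_dom c))
      (fun x => vector_coord c (e (chart_inv c x)).1) /\
    smooth_on (c @` (U `&` chart_dom c))
      (fun x => covector_coord c (e (chart_inv c x)).2).

Definition smooth_csection (U : set M)
    (e : forall p : M, cplx (TT R (tangent p))) : Prop :=
  smooth_section U (fun p => cre (e p)) /\ smooth_section U (fun p => cim (e p)).

Definition smooth_subbundle
    (L : forall p : M, {vspace cplx (TT R (tangent p))}) : Prop :=
  exists k : nat, forall p : M, exists U : set M, [/\ open U, U p &
    exists e : 'I_k -> forall q : M, cplx (TT R (tangent q)),
      (forall i, smooth_csection U (e i)) /\
      (forall q, U q -> basis_of (L q) [seq e i q | i <- enum 'I_k])].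

Definition lagrangian_subbundle
    (L : forall p : M, {vspace cplx (TT R (tangent p))}) : Prop :=
  smooth_subbundle L /\ forall p, lagrangian (L p).

End Sections.
End Smooth.

(* Main.v *)
(* Write E = pr L, F = E /\ conj E (the complexification of Delta), and split
   E = E' + F.  Then E' /\ conj E = 0, so the real parts of E' span a real space
   C with C /\ Delta = 0 on which multiplication by i on E' becomes a complex
   structure; N is any complement of Delta containing C.  Let P be the
   complexified projection on Delta along N, and S a projection on E killing
   conj E'.  On E one has S X = X and S (conj X) = conj (P X), so the real form
   B = 2 Re (eps(S,S) - eps(P,P)/2) restricts on E to
   eps - i omega_Delta(P,P).  A lagrangian subspace being determined by E and
   eps, this gives L = e^B (L_{i omega} x L_{(C,J)}). *)
Require Import Defs.
From HB Require Import structures.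
From mathcomp Require Import all_boot all_order all_algebra ring complex.
From mathcomp Require Import all_classical all_reals all_analysis.

Set Implicit Arguments.
Unset Strict Implicit.
Unset Printing Implicit Defensive.

Import Order.TTheory GRing.Theory Num.Theory.
Import numFieldNormedType.Exports.

Local Open Scope classical_set_scope.
Local Open Scope ring_scope.
Local Open Scope complex_scope.

(** * Linear algebra: packaging maps as ['Hom], linear lifts, adapted complements *)

Section LinearMaps.
Context {K : fieldType}.

Lemma linfunE (V W : vectType K) (f : V -> W) : linear f -> linfun f =1 f.
Proof.
move=> lin; pose m := GRing.isLinear.Build _ _ _ _ f lin.
pose g : {linear V -> W} := HB.pack f m.
by move=> x; exact: (lfunE g).
Qed.

Lemma linear_lfun (V W : vectType K) (f : V -> W) :
  linear f -> exists h : 'Hom(V, W), h =1 f.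
Proof. by move=> lin; exists (linfun f); exact: linfunE. Qed.

Lemma bilinear_lfun (V W U : vectType K) (f : V -> W -> U) :
  (forall x, linear (f x)) -> (forall y, linear (f^~ y)) ->
  exists b : 'Hom(V, 'Hom(W, U)), forall x y, b x y = f x y.
Proof.
move=> linr linl.
have /choice[g gE] : forall x, exists h : 'Hom(W, U), h =1 f x.
  by move=> x; exact: linear_lfun.
have /linear_lfun[b bE] : linear g.
  by move=> a x y; apply/lfunP => z; rewrite add_lfunE scale_lfunE !gE linl.
by exists b => x y; rewrite bE gE.
Qed.

(** The pseudo-inverse of [f \o projv U] is a right inverse on its image, which is [f @: U];
    projecting its values to [U] afterwards does not change their image under [f \o projv U]. With
    [f] the tangent projection and [U = L], this lifts vectors of E to [L] linearly. *)
Lemma lift_image (V W : vectType K) (f : 'Hom(V, W)) (U : {vspace V}) :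
  exists g : 'Hom(W, V),
    (forall w, g w \in U) /\ {in (f @: U)%VS, cancel g f}.
Proof.
exists (projv U \o (f \o projv U)^-1)%VF; split=> [w|w wU].
  by rewrite comp_lfunE memv_proj.
rewrite comp_lfunE -[f _]comp_lfunE limg_lfunVK// limg_comp.
suff -> : limg (projv U) = U by [].
apply/eqP; rewrite eqEsubv; apply/andP; split; apply/subvP => u.
  by move=> /memv_imgP[v _ ->]; exact: memv_proj.
by move=> uU; rewrite -(projv_id uU) memv_img ?memvf.
Qed.

Lemma daddv_pi_eq0 (V : vectType K) (U W : {vspace V}) w :
  (U :&: W)%VS = 0%VS -> w \in W -> daddv_pi U W w = 0.
Proof.
move=> UW0 wW; have wUW : w \in (U + W)%VS by exact: (subvP (addvSr _ _)).
move/(canRL (addrK _)): (daddv_pi_add UW0 wUW).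
by rewrite (daddv_pi_id _ wW) 1?capvC// subrr.
Qed.

Lemma complement_containing (V : vectType K) (U W : {vspace V}) :
  (U :&: W)%VS = 0%VS ->
  exists N : {vspace V},
    [/\ (U + N = fullv)%VS, (U :&: N = 0)%VS & (W <= N)%VS].
Proof.
move=> UW0; exists (W + (U + W)^C)%VS; split; last exact: addvSl.
  by rewrite addvA addv_complf.
apply/eqP; rewrite -subv0; apply/subvP => x; rewrite memv_cap => /andP[xU].
move=> /memv_addP[w wW [z zC xwz]].
have z0 : z \in ((U + W) :&: (U + W)^C)%VS.
  rewrite memv_cap zC andbT (_ : z = x - w); last by rewrite xwz addrC addKr.
  by rewrite memvB// ?(subvP (addvSl _ _) _ xU)// (subvP (addvSr _ _) _ wW).
move: z0; rewrite capv_compl memv0 => /eqP z0.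
by rewrite -UW0 memv_cap xU xwz z0 addr0.
Qed.

End LinearMaps.

(** * Conjugation, real parts and evaluation on complexifications *)

Section Complexification.
Context {R : rcfType}.

Lemma cconjK (V : lmodType R) : involutive (@cconj R V).
Proof. by case=> x y; rewrite /cconj /= opprK. Qed.

Lemma cconjP (V : lmodType R) (a : R[i]) (u v : cplx V) :
  cconj (a *: u + v) = a^* *: cconj u + cconj v.
Proof.
case: a u v => [p q] [x y] [z t]; congr Cplx => /=.
  by rewrite scalerN scaleNr opprK.
by rewrite !opprD scalerN scaleNr.
Qed.

Lemma cconjZ (V : lmodType R) (a : R[i]) (u : cplx V) :
  cconj (a *: u) = a^* *: cconj u.
Proof.
case: a u => [p q] [x y]; congr Cplx => /=.
  by rewrite scalerN scaleNr opprK.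
by rewrite !opprD scalerN scaleNr.
Qed.

Lemma cconjD (V : lmodType R) (u v : cplx V) :
  cconj (u + v) = cconj u + cconj v.
Proof. by rewrite -[u in LHS]scale1r cconjP rmorph1 scale1r. Qed.

Lemma cconj_creal (V : lmodType R) (x : V) : cconj (creal x) = creal x.
Proof. by rewrite /cconj /creal /= oppr0. Qed.

Lemma cconj_cmap (V W : lmodType R) (f : {linear V -> W}) (u : cplx V) :
  cconj (cmap f u) = cmap f (cconj u).
Proof. by rewrite /cconj /cmap /= linearN. Qed.

Lemma cplx_creal (V : lmodType R) (u : cplx V) :
  u = creal (cre u) + 'i *: creal (cim u).
Proof.
case: u => x y; congr Cplx => /=.
  by rewrite scale0r scaler0 subr0 addr0.
by rewrite scale0r scale1r !add0r.
Qed.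

Lemma creal_linear (V : lmodType R) (a : R) (x y : V) :
  creal (a *: x + y) = a%:C *: creal x + creal y.
Proof.
by congr Cplx; rewrite /= !(scaler0, scale0r, subr0, addr0).
Qed.

Lemma creal_cre (V : lmodType R) (u : cplx V) :
  creal (cre u) = 2^-1 *: (u + cconj u).
Proof.
have -> : u + cconj u = 2%:R *: creal (cre u).
  rewrite scaler_nat mulr2n; case: u => x y.
  by congr Cplx; rewrite /= ?subrr ?addr0.
by rewrite scalerA mulVf ?scale1r// pnatr_eq0.
Qed.

(** Complex subspaces are stable under -i, so facts about real parts of their elements carry over to
    imaginary parts. *)
Lemma cim_cre (V : lmodType R) (u : cplx V) : cim u = cre (- 'i *: u).
Proof.
by case: u => x y /=; rewrite oppr0 scale0r scaleNr scale1r sub0r opprK.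
Qed.

Lemma mem_cre_Rev (V : vectType R) (F : {vspace cplx V}) (u : cplx V) :
  u \in F -> cconj u \in F -> cre u \in Rev F /\ cim u \in Rev F.
Proof.
move=> uF cuF; rewrite cim_cre; split; apply/mem_Rev.
  by rewrite creal_cre memvZ ?memvD.
by rewrite creal_cre cconjZ memvZ ?memvD ?memvZ.
Qed.

Section Ev.
Context {V : vectType R}.
Implicit Types (xi eta : cplx 'Hom(V, R^o)) (X Y : cplx V) (a : R[i]).

Lemma ev_linearr xi : linear (ev xi : cplx V -> R[i]^o).
Proof.
case=> [p q] [x y] [z t].
rewrite /ev /cbil /= !linearD !linearN !linearZ /= /GRing.scale /=.
by apply/eqP; rewrite eq_complex /=; apply/andP; split; apply/eqP; ring.
Qed.

Lemma ev_linearl X :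
  linear ((fun xi => ev xi X) : cplx 'Hom(V, R^o) -> R[i]^o).
Proof.
case=> [p q] [x y] [z t].
rewrite /ev /cbil /= !(add_lfunE, opp_lfunE, scale_lfunE) /GRing.scale /=.
by apply/eqP; rewrite eq_complex /=; apply/andP; split; apply/eqP; ring.
Qed.

Lemma ev_ext xi eta : (forall Y, ev xi Y = ev eta Y) -> xi = eta.
Proof.
case: xi eta => [x y] [z t] eq_ev; congr Cplx; apply/lfunP => v;
  case: (eq_ev (creal v)) => /=;
  by rewrite !(linear0, oppr0, addr0, add0r).
Qed.

Lemma real_part_form (t : 'Hom(cplx V, 'Hom(cplx V, R[i]^o))) :
  exists b : 'Hom(V, 'Hom(V, R^o)),
    forall x y, b x y = complex.Re (t (creal x) (creal y)).
Proof.
have ReP (a : R) (z w : R[i]) :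
    complex.Re (a%:C * z + w) = a * complex.Re z + complex.Re w.
  by case: z w => [p q] [p' q'] /=; rewrite mul0r subr0.
apply: (bilinear_lfun (U := R^o)) => [x|y] a z w.
  by rewrite creal_linear linearP ReP.
by rewrite creal_linear linearP add_lfunE scale_lfunE ReP.
Qed.

(** The complex-bilinear extension of Re t is the average of t and its conjugate form. Both sides
    are expanded into the four values of [t] on real and imaginary parts. *)
Lemma ev_cmap_Re (t : 'Hom(cplx V, 'Hom(cplx V, R[i]^o)))
    (b : 'Hom(V, 'Hom(V, R^o))) :
  (forall x y, b x y = complex.Re (t (creal x) (creal y))) ->
  forall X Y, ev (cmap b X) Y = 2^-1 * (t X Y + (t (cconj X) (cconj Y))^*).
Proof.
move=> bE X Y; rewrite {1}/ev /cbil /= !bE.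
have cE (Z : cplx V) : creal (cim (cconj Z)) = - creal (cim Z).
  by congr Cplx; rewrite /= oppr0.
have tE (Z T : cplx V) : t Z T =
    t (creal (cre Z)) (creal (cre T)) + 'i * t (creal (cre Z)) (creal (cim T)) +
    'i * (t (creal (cim Z)) (creal (cre T)) +
          'i * t (creal (cim Z)) (creal (cim T))).
  rewrite [in LHS](cplx_creal Z) linearD linearZ add_lfunE scale_lfunE.
  by rewrite [in LHS](cplx_creal T) !linearD !linearZ /= mulrDr.
rewrite (tE X) (tE (cconj X)) !cE !(linearN, opp_lfunE) /= ?opp_lfunE ?opprK.
move: (t _ _) (t _ _) (t _ _) (t _ _) => [p p'] [q q'] [x x'] [y y'].
apply: (@mulfI _ (2%:R : R[i])); first by rewrite pnatr_eq0.
rewrite [RHS]mulrA mulfV ?pnatr_eq0// mul1r mulr_natl mulr2n.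
by apply/eqP; rewrite eq_complex /=; apply/andP; split; apply/eqP; ring.
Qed.

End Ev.

Lemma evDl (V : vectType R) (xi eta : cplx 'Hom(V, R^o)) X :
  ev (xi + eta) X = ev xi X + ev eta X.
Proof. by rewrite -[xi in LHS]scale1r ev_linearl scale1r. Qed.

Lemma evZl (V : vectType R) a (xi : cplx 'Hom(V, R^o)) X :
  ev (a *: xi) X = a * ev xi X.
Proof.
have ev0 : ev (0 : cplx 'Hom(V, R^o)) X = 0.
  by rewrite -[0 in LHS](subrr 0) ev_subl subrr.
by rewrite -[_ *: _]addr0 ev_linearl ev0 addr0.
Qed.

Lemma evDr (V : vectType R) (xi : cplx 'Hom(V, R^o)) X Y :
  ev xi (X + Y) = ev xi X + ev xi Y.
Proof. by rewrite -[X in LHS]scale1r ev_linearr scale1r. Qed.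

Lemma evBr (V : vectType R) (xi : cplx 'Hom(V, R^o)) X Y :
  ev xi (X - Y) = ev xi X - ev xi Y.
Proof. by apply/(canRL (addrK _)); rewrite -evDr subrK. Qed.

Lemma ev0r (V : vectType R) (xi : cplx 'Hom(V, R^o)) : ev xi 0 = 0.
Proof. by rewrite -[0 in LHS](subrr 0) evBr subrr. Qed.

Lemma cplx_pair_ext (V W : Type) (u v : cplx (V * W)) :
  cmap fst u = cmap fst v -> cmap snd u = cmap snd v -> u = v.
Proof.
by case: u v => [[x x'] [y y']] [[z z'] [t t']] [/= -> ->] [-> ->].
Qed.

Lemma cmap_fst_cpair (V W : Type) (X : cplx V) (xi : cplx W) :
  cmap fst (cpair X xi) = X.
Proof. by case: X. Qed.

Lemma cmap_snd_cpair (V W : Type) (X : cplx V) (xi : cplx W) :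
  cmap snd (cpair X xi) = xi.
Proof. by case: xi. Qed.

Lemma cmap_fst_expB (V : vectType R) (B : 'Hom(V, 'Hom(V, R^o))) u :
  cmap fst (cmap (expB B) u) = cmap fst u.
Proof. by []. Qed.

Lemma cmap_snd_expB (V : vectType R) (B : 'Hom(V, 'Hom(V, R^o))) u :
  cmap snd (cmap (expB B) u) = cmap snd u + cmap B (cmap fst u).
Proof. by []. Qed.

End Complexification.

(** * A lagrangian subspace is determined by E and eps *)

Section Extension.
Context {R : rcfType} {V : vectType R} (L : {vspace cplx (TT R V)}).
Context (lagL : lagrangian L).

(** [eps] rests on a pointwise choice of lift and is not visibly linear in its first argument. A
    linear lift [g] of E into [L] gives a globally bilinear form, and isotropy of [g X] makes it
    alternating on E. *)
Lemma eps_extension :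
  exists2 e : 'Hom(cplx V, 'Hom(cplx V, R[i]^o)),
    {in range_sp L &, forall X Y, e X Y = eps L X Y} &
    {in range_sp L, forall X, e X X = 0}.
Proof.
have [g [gL gK]] := lift_image (linfun (cmap (@fst V 'Hom(V, R^o)))) L.
have fgK X : X \in range_sp L -> cmap fst (g X) = X.
  by move/gK; rewrite lfunE.
have [||e eE] := @bilinear_lfun _ (cplx V) (cplx V) R[i]^o
  (fun X Y => ev (cmap snd (g X)) Y).
- by move=> X; exact: ev_linearr.
- by move=> Y a X X'; rewrite !linearP ev_linearl.
exists e => [X Y XE YE|X XE]; rewrite eE.
  by rewrite -[X in RHS]fgK// epsE.
have /eqP := (lagL (g X)).1 (gL X) _ (gL X).
rewrite cbil_pairing -mulr2n mulf_eq0 => /orP[|].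
  by rewrite eq_complex /= eqxx andbT invr_eq0 pnatr_eq0.
by rewrite mulrn_eq0 orFb fgK// => /eqP.
Qed.

(** An element [v] of [L] over the same tangent vector pairs with every element of [L] exactly as
    [u] does; hence [u] is orthogonal to [L], and L is its own orthogonal. *)
Lemma mem_lagrangian u : cmap fst u \in range_sp L ->
  (forall Y, Y \in range_sp L -> ev (cmap snd u) Y = eps L (cmap fst u) Y) ->
  u \in L.
Proof.
move=> uE evu; have /range_spP[v vL uv] := uE.
apply/lagL => w wL; have wE : cmap fst w \in range_sp L.
  by apply/range_spP; exists w.
by rewrite cbil_pairing evu// uv epsE// -cbil_pairing; exact: (lagL v).1.
Qed.

End Extension.

(** * The CR part of E and a complement of Delta adapted to it *)

Section Splitting.
Context {R : rcfType} {V : vectType R}.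

(* [J] is multiplication by [i] on [E'] read on real parts:
   [cre ('i *: X) = - cim X]. *)
Lemma CR_splitting (E : {vspace cplx V}) :
  exists (E' : {vspace cplx V}) (C N : {vspace V})
         (S : 'End(cplx V)) (J : 'End(V)),
    [/\ [/\ (E' + E :&: conjv E = E)%VS,
            forall X, S X \in E, {in E, forall X, S X = X} &
            {in E', forall X, S (cconj X) = 0}],
        [/\ {in E', forall X, J (cre X) = - cim X},
            {in E', forall X, cre X \in C} &
            forall x, x \in C -> exists2 X, X \in E' & x = cre X] &
        [/\ (Rev (E :&: conjv E) + N = fullv)%VS,
            (Rev (E :&: conjv E) :&: N = 0)%VS & (C <= N)%VS]].
Proof.
pose E' := (E :\: conjv E)%VS; pose C := Rev (E' + conjv E').
have E'E : (E' <= E)%VS by exact: diffvSl.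
have E'cE : (E' :&: conjv E = 0)%VS by exact: capv_diff.
have EcE' : (E :&: conjv E' = 0)%VS.
  apply/eqP; rewrite -subv0; apply/subvP => X; rewrite memv_cap => /andP[XE].
  move/mem_conjv => cXE'; have : cconj X \in (E' :&: conjv E)%VS.
    by rewrite memv_cap cXE'; apply/mem_conjv; rewrite cconjK.
  rewrite E'cE !memv0 => /eqP/(congr1 (@cconj R V)).
  by rewrite cconjK => ->; apply/eqP; congr Cplx; rewrite /= oppr0.
(* Projection onto E along conj E'. On X + conj X with X in E' it returns X, so X is recovered from
   its real part. *)
pose S := daddv_pi E (conjv E').
have SE X : X \in E -> S X = X by exact: daddv_pi_id.
have ScE X : X \in E' -> S (cconj X) = 0.
  by move=> XE'; apply: daddv_pi_eq0 => //; apply/mem_conjv; rewrite cconjK.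
have E'C X : X \in E' -> cre X \in C.
  move=> XE'; have XE'c : X \in (E' + conjv E')%VS.
    exact: (subvP (addvSl _ _)).
  apply: (mem_cre_Rev XE'c _).1.
  by apply: (subvP (addvSr _ _)); apply/mem_conjv; rewrite cconjK.
have CE' x : x \in C -> exists2 X, X \in E' & x = cre X.
  move=> /mem_Rev/memv_addP[X XE' [Y /mem_conjv YE' xXY]].
  by exists (X + cconj Y); rewrite ?memvD//= -[LHS]/(cre (creal x)) xXY.
(* Suppose x in Delta is the real part of X in E'. Applying [S] to 2x = X + conj X, with 2x in E,
   gives 2x = X. So X lies in conj E as well as in E', hence X = 0 and x = 0. *)
have [|N [DN DN0 CN]] := @complement_containing _ V (Rev (E :&: conjv E)) C.
  apply/eqP; rewrite -subv0; apply/subvP => x; rewrite memv_cap => /andP[].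
  move=> /mem_Rev; rewrite memv_cap => /andP[xE xcE].
  move=> /CE'[X XE' xX]; rewrite memv0.
  have SX : 2%:R *: creal x = X.
    have xE2 : 2%:R *: creal x \in E by rewrite memvZ.
    rewrite -(SE _ xE2) xX creal_cre scalerA mulfV ?pnatr_eq0// scale1r.
    by rewrite linearD /= SE ?(subvP E'E)// ScE// addr0.
  have : X \in (E' :&: conjv E)%VS by rewrite memv_cap XE' -SX memvZ.
  by rewrite E'cE memv0 xX => /eqP ->.
have [|J JE] := @linear_lfun _ V V (fun x => - cim (S (2%:R *: creal x))).
  move=> a x y; rewrite creal_linear scalerDr scalerA mulrC -scalerA linearP /=.
  by rewrite scale0r addr0 opprD scalerN.
exists E', C, N, S, J; split; split=> //.
- by rewrite addv_diff_cap.
- by move=> X; exact: memv_pi.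
move=> X XE'.
rewrite JE creal_cre scalerA mulfV ?pnatr_eq0// scale1r.
by rewrite linearD /= SE ?(subvP E'E)// ScE// addr0.
Qed.

End Splitting.

(** * The CR structure on N and the identification of V with a direct sum *)

Section Models.
Context {R : rcfType} {V : vectType R}.

(** An element of E' is determined by its real part, since [J] returns minus its imaginary part. The
    equation J W = i W says the same of W, so W is the element of E' with the real part of W. The
    rest transports [C] and [J] into the nested subspace types. *)
Lemma CR_structure (E' : {vspace cplx V}) (C N : {vspace V}) (J : 'End(V)) :
  (C <= N)%VS -> {in E', forall X, J (cre X) = - cim X} ->
  {in E', forall X, cre X \in C} ->
  (forall x, x \in C -> exists2 X, X \in E' & x = cre X) ->
  exists (C' : {vspace subvs_of N}) (J' : 'End(subvs_of C')),
    almost_CR J' /\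
    forall X : cplx (subvs_of N), C10 J' X <-> cmap vsval X \in E'.
Proof.
move=> CN JE' E'C CE'.
have E'cim X : X \in E' -> cim X \in C.
  by move=> XE'; rewrite cim_cre E'C// memvZ.
have JC x : x \in C -> J x \in C.
  by move=> /CE'[X XE' ->]; rewrite JE'// memvN E'cim.
(* J (Re X) = - Re (-i X), and -i X is again in E', so [JE'] applies a second time. *)
have JJ x : x \in C -> J (J x) = - x.
  move=> /CE'[X XE' ->]; rewrite JE'// linearN/= cim_cre JE'.
    rewrite opprK; case: X {XE'} => x1 x2 /=.
    by rewrite oppr0 scale0r add0r scaleN1r.
  by rewrite memvZ.
pose C' := (linfun (vsval : subvs_of N -> V) @^-1: C)%VS.
have memC' x : (x \in C') = (vsval x \in C) by rewrite -memv_preim lfunE.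
have [|J' J'E] := @linear_lfun _ (subvs_of C') (subvs_of C')
  (fun x => vsproj C' (vsproj N (J (vsval (vsval x))))).
  by move=> a x y; rewrite !linearP.
have valC' (x : subvs_of C') : vsval (vsval x) \in C by rewrite -memC' subvsP.
have J'val x : vsval (vsval (J' x)) = J (vsval (vsval x)).
  have JN : J (vsval (vsval x)) \in N by rewrite (subvP CN)// JC.
  by rewrite J'E vsprojK ?vsprojK// memC' vsprojK// JC.
exists C', J'; split=> [|Z].
  apply/lfunP => x; rewrite comp_lfunE opp_lfunE id_lfunE.
  by apply/val_inj/val_inj; rewrite /= !J'val JJ.
split=> [[W /= JW <-]|ZE'].
  have /CE'[X XE' cX] := valC' (cre W).
  suff -> : cmap vsval (cmap vsval W) = X by [].
  have := congr1 (@cre _) JW; rewrite /= scale0r scale1r sub0r.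
  move=> /(congr1 (fun x => vsval (vsval x))).
  rewrite J'val cX JE'// !linearN/= => /oppr_inj.
  by case: X cX {XE'} => x1 x2 /= <- ->.
have Zre : cre Z \in C' by rewrite memC'; exact: (E'C _ ZE').
have Zim : cim Z \in C' by rewrite memC'; exact: (E'cim _ ZE').
exists (Cplx (vsproj C' (cre Z)) (vsproj C' (cim Z))); last first.
  by case: Z Zre Zim {ZE'} => x y /= xC yC; congr Cplx; rewrite vsprojK.
congr Cplx; apply/val_inj/val_inj; rewrite /= !J'val !vsprojK//.
  by rewrite scale0r scale1r sub0r; exact: (JE' _ ZE').
rewrite scale0r scale1r add0r.
(* The imaginary part of J Z = i Z is the real-part identity for -i Z. *)
have := JE' (- 'i *: cmap vsval Z); rewrite -cim_cre => ->.
  2: by rewrite memvZ.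
by case: Z {ZE' Zre Zim} => x y /=; rewrite oppr0 scale0r add0r scaleN1r opprK.
Qed.

Lemma sum_isoE (D N : {vspace V}) p : sum_iso D N p = vsval p.1 + vsval p.2.
Proof.
apply: (linfunE _ p) => a [x1 x2] [y1 y2] /=.
by rewrite scalerDr addrACA.
Qed.

Lemma sum_iso_bij (D N : {vspace V}) :
  (D + N = fullv)%VS -> (D :&: N = 0)%VS ->
  cancel (sum_iso D N) (sum_iso D N)^-1%VF /\
  cancel (sum_iso D N)^-1%VF (sum_iso D N).
Proof.
move=> DN DN0; split=> [|x].
  apply/lker0_lfunK/lker0P => -[x1 x2] [y1 y2].
  rewrite !sum_isoE /= => xy.
  have d : vsval x1 - vsval y1 = vsval y2 - vsval x2.
    by apply/eqP; rewrite subr_eq addrAC eq_sym subr_eq xy addrC.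
  have : vsval x1 - vsval y1 \in (D :&: N)%VS.
    by rewrite memv_cap {2}d !memvB ?subvsP.
  rewrite DN0 memv0 => d0; have /eqP := d0; rewrite d => /eqP.
  by move: d0; rewrite !subr_eq0 => /eqP/val_inj -> /eqP/val_inj ->.
apply: limg_lfunVK; have : x \in (D + N)%VS by rewrite DN memvf.
move=> /memv_addP[y yD [z zN ->]].
have -> : y + z = sum_iso D N (vsproj D y, vsproj N z).
  by rewrite sum_isoE !vsprojK.
by rewrite memv_img ?memvf.
Qed.

End Models.

(** * Elements of the product model transported to V *)

Section ProductModel.
Context {R : rcfType} {V : vectType R} (D N : {vspace V}).
Let Phi := sum_iso D N.
Implicit Types (u : cplx (TT R (subvs_of D))) (v : cplx (TT R (subvs_of N))).

(** When V is the direct sum of D and N, this and [sum_proj2] are the projections onto each summand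
    along the other. *)
Definition sum_proj1 : 'Hom(V, subvs_of D) :=
  (linfun (@fst (subvs_of D) (subvs_of N)) \o Phi^-1)%VF.

Definition sum_proj2 : 'Hom(V, subvs_of N) :=
  (linfun (@snd (subvs_of D) (subvs_of N)) \o Phi^-1)%VF.

Definition sum_prod u v : cplx (TT R V) :=
  cmap (TTmap Phi) (cmap (@inT1 R (subvs_of D) (subvs_of N)) u +
                    cmap (@inT2 R (subvs_of D) (subvs_of N)) v).

Lemma cmap_fst_sum_prod u v :
  cmap fst (sum_prod u v) = cmap vsval (cmap fst u) + cmap vsval (cmap fst v).
Proof. by congr Cplx; rewrite /= sum_isoE /= addr0 add0r. Qed.

Lemma ev_sum_prod u v Y :
  ev (cmap snd (sum_prod u v)) Y =
  ev (cmap snd u) (cmap sum_proj1 Y) + ev (cmap snd v) (cmap sum_proj2 Y).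
Proof.
rewrite /ev /cbil /= !comp_lfunE !add_lfunE !comp_lfunE !lfunE /=.
by apply/eqP; rewrite eq_complex /=; apply/andP; split; apply/eqP; ring.
Qed.

Context (DN : (D + N = fullv)%VS) (DN0 : (D :&: N = 0)%VS).

Lemma sum_projK x : vsval (sum_proj1 x) + vsval (sum_proj2 x) = x.
Proof.
have [_ K] := sum_iso_bij DN DN0.
by rewrite !comp_lfunE !lfunE /= -sum_isoE K.
Qed.

Lemma sum_proj1_sum (x : subvs_of D) (y : subvs_of N) :
  sum_proj1 (vsval x + vsval y) = x.
Proof.
have [K _] := sum_iso_bij DN DN0.
by rewrite comp_lfunE lfunE /= -[_ + _](sum_isoE (x, y)) K.
Qed.

Lemma sum_proj1_id x : x \in D -> vsval (sum_proj1 x) = x.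
Proof.
move=> xD; have := sum_proj1_sum (vsproj D x) 0.
by rewrite vsprojK// linear0 addr0 => ->; rewrite vsprojK.
Qed.

Lemma sum_proj1_eq0 x : x \in N -> sum_proj1 x = 0.
Proof.
move=> xN; have := sum_proj1_sum 0 (vsproj N x).
by rewrite vsprojK// linear0 add0r.
Qed.

End ProductModel.

(** * The normal form of a lagrangian subspace, then of a subbundle at a point *)

Lemma lagrangian_normal_form (R : rcfType) (V : vectType R)
    (L : {vspace cplx (TT R V)}) :
  lagrangian L ->
  exists (N : {vspace V}) (B : 'Hom(V, 'Hom(V, R^o)))
         (C : {vspace subvs_of N}) (J : 'End(subvs_of C)),
    [/\ (Delta_sp L + N = fullv)%VS, (Delta_sp L :&: N = 0)%VS,
        two_form B, almost_CR J &
        [set u | u \in L] =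
        cmap (expB B) @`
          (cmap (TTmap (sum_iso (Delta_sp L) N)) @`
             L_prod (L_i (omega_Delta L)) (L_CR J))].
Proof.
move=> lagL; have [e eE eA] := eps_extension lagL.
have [E' [C [N [S [J0]]]]] := CR_splitting (range_sp L).
set E := range_sp L in eE eA *; set F := (E :&: conjv E)%VS.
rewrite -[Rev F]/(Delta_sp L); set D := Delta_sp L.
move=> [[E'F SE Sid ScE'] [JE' E'C CE'] [DN DN0 CN]].
have [C' [J [Jcr C10E]]] := CR_structure CN JE' E'C CE'.
have E'E X : X \in E' -> X \in E by rewrite -E'F; exact/subvP/addvSl.
have FE X : X \in F -> X \in E by apply/subvP/capvSl.
have FcE X : X \in F -> cconj X \in E.
  by rewrite memv_cap => /andP[_ /mem_conjv].
have DF (X : cplx (subvs_of D)) : cmap vsval X \in F.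
  rewrite [cmap _ _]cplx_creal memvD ?memvZ//=;
  by apply/mem_Rev; exact: subvsP.
pose P X := cmap vsval (cmap (sum_proj1 D N) X) : cplx V.
have PF X : P X \in F by exact: DF.
have PD X : X \in F -> P X = X.
  move=> XF; have cXF : cconj X \in F.
    by rewrite memv_cap FcE//; apply/mem_conjv; rewrite cconjK FE.
  have [Xre Xim] := mem_cre_Rev XF cXF.
  case: X Xre Xim {XF cXF} => x y /= xD yD.
  by congr Cplx; rewrite /= sum_proj1_id.
have PE' X : X \in E' -> P X = 0.
  move=> XE'; have XreN : cre X \in N by rewrite (subvP CN)// E'C.
  have XimN : cim X \in N by rewrite (subvP CN)// cim_cre E'C// memvZ.
  by congr Cplx; rewrite /= sum_proj1_eq0.
have Plin a X Y : P (a *: X + Y) = a *: P X + P Y by rewrite /P !linearP.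
have PD' X Y : P (X + Y) = P X + P Y by rewrite /P !linearD.
have vN Y : cmap vsval (cmap (sum_proj2 D N) Y) = Y - P Y.
  apply/(canRL (addrK _)); case: Y => x y.
  by congr Cplx; rewrite /= addrC sum_projK.
have Psub X : X \in E -> X - P X \in E'.
  rewrite -{1}E'F => /memv_addP[Y YE' [Z ZF ->]].
  by rewrite PD' (PE' Y)// (PD Z)// add0r addrK.
(* Split X as (X - P X) + P X: [S] kills the conjugate of the E' part and fixes that of the F part,
   because F is stable under conjugation. *)
have ScE X : X \in E -> S (cconj X) = cconj (P X).
  move=> XE; rewrite -[X in LHS](subrK (P X)) cconjD linearD /= ScE' ?Psub//.
  by rewrite add0r Sid// FcE.
have Pc X : P (cconj X) = cconj (P X) by rewrite /P !cconj_cmap.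
have sc (a : R[i]) (z : R[i]^o) : a *: z = a * z by [].
(* B is Re t. The factor 2 offsets the 1/2 in [ev_cmap_Re]. *)
have [||t tE] := @bilinear_lfun _ (cplx V) (cplx V) R[i]^o
  (fun X Y => 2%:R * e (S X) (S Y) - e (P X) (P Y)).
- by move=> X a Y Z; rewrite Plin !linearP /= !sc; ring.
- move=> Y a X Z; rewrite Plin !linearP !add_lfunE !scale_lfunE /= !sc.
  by ring.
have [B BE] := real_part_form t.
have evB := ev_cmap_Re BE.
(* Since Im z = Re (-i z), omega_Delta is also a real part, and [ev_cmap_Re] applies to it. *)
have [||s sE] := @bilinear_lfun _ (cplx (subvs_of D)) (cplx (subvs_of D)) R[i]^o
  (fun X Y => - 'i * e (cmap vsval X) (cmap vsval Y)).
- by move=> X a Y Z; rewrite !linearP /= !sc; ring.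
- move=> Y a X Z; rewrite !linearP !add_lfunE !scale_lfunE /= !sc.
  by ring.
have DE (x : subvs_of D) : creal (vsval x) \in E.
  by apply/FE/mem_Rev; exact: subvsP.
have sO x y : omega_Delta L x y = complex.Re (s (creal x) (creal y)).
  rewrite omega_DeltaE// -eE ?DE// sE.
  rewrite (_ : cmap vsval (creal x) = creal (vsval x))//.
  rewrite (_ : cmap vsval (creal y) = creal (vsval y))//.
  by case: (e _ _) => p q /=; rewrite mulN1r oppr0 mul0r sub0r opprK.
have evO := ev_cmap_Re sO.
(* With a = e(P X, P Y) and b the conjugate of e(conj P X, conj P Y), the omega term is (a - b)/2
   and the B term is e(X, Y) - (a - b)/2. *)
have key X Y : X \in E -> Y \in E ->
    'i * ev (cmap (omega_Delta L) (cmap (sum_proj1 D N) X))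
            (cmap (sum_proj1 D N) Y) +
    ev (cmap B X) Y = eps L X Y.
  move=> XE YE; rewrite -eE// evO evB !sE !tE.
  rewrite (Sid X)// (Sid Y)// (ScE X)// (ScE Y)// -!cconj_cmap -!/(P _) !Pc.
  move: (e (P X) (P Y)) (e (cconj (P X)) _) (e X Y) => [p p'] [q q'] [x x'].
  apply: (@mulfI _ (2%:R : R[i])); first by rewrite pnatr_eq0.
  rewrite [in LHS]mulrCA -mulrDr mulrA mulfV ?pnatr_eq0// mul1r.
  rewrite !mulr_natl !mulr2n.
  by apply/eqP; rewrite eq_complex /=; apply/andP; split; apply/eqP; ring.
exists N, B, C', J; split=> // [x|].
  rewrite BE tE !eA ?SE// ?mulr0 ?subr0//; exact/FE/PF.
apply/seteqP; split=> [u uL|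
    _ [_ [_ [_ [X1 _ <-]] [_ [X2 X2C [eta etaA <-]] <-] <-] <-]].
  have XE : cmap fst u \in E by apply/range_spP; exists u.
  set X := cmap fst u in XE.
  (* [theta] is the covector part of e^(-B) u, and [eta] is its restriction to N. It annihilates E'
     because vectors of E' have no Delta component. *)
  pose theta := cmap snd u - cmap B X.
  pose eta : cplx 'Hom(subvs_of N, R^o) :=
    cmap (fun f : 'Hom(V, R^o) => (f \o linfun vsval)%VF) theta.
  have evt Y : Y \in E -> ev theta Y =
      'i * ev (cmap (omega_Delta L) (cmap (sum_proj1 D N) X))
              (cmap (sum_proj1 D N) Y).
    by move=> YE; rewrite ev_subl -(epsE lagL uL YE) -key// addrK.
  have evn Z : ev eta Z = ev theta (cmap vsval Z).
    by rewrite /ev /cbil /= !comp_lfunE !lfunE.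
  have C10X : C10 J (cmap (sum_proj2 D N) X) by apply/C10E; rewrite vN Psub.
  have Aeta : Ann (C10 J) eta.
    move=> Z /C10E ZE'; rewrite evn evt ?E'E//.
    have -> : cmap (sum_proj1 D N) (cmap vsval Z) = 0.
      by congr Cplx; rewrite /= sum_proj1_eq0 ?subvsP.
    by rewrite ev0r mulr0.
  pose u1 : cplx (TT R (subvs_of D)) := cpair (cmap (sum_proj1 D N) X)
    ('i *: (cmap (omega_Delta L) (cmap (sum_proj1 D N) X))).
  pose u2 : cplx (TT R (subvs_of N)) := cpair (cmap (sum_proj2 D N) X) eta.
  exists (sum_prod u1 u2).
    exists (cmap (@inT1 R (subvs_of D) (subvs_of N)) u1 +
            cmap (@inT2 R (subvs_of D) (subvs_of N)) u2) => //.
    exists u1; first by exists (cmap (sum_proj1 D N) X).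
    by exists u2 => //; exists (cmap (sum_proj2 D N) X) => //; exists eta.
  have wE : cmap fst (sum_prod u1 u2) = X.
    by rewrite cmap_fst_sum_prod !cmap_fst_cpair vN -/(P X) addrC subrK.
  apply: cplx_pair_ext; first exact: wE.
  (* Y is arbitrary here, not only in E: on P Y, which lies in E, [evt] applies, and on Y - P Y the
     definition of [eta] does. *)
  apply: ev_ext => Y; rewrite cmap_snd_expB evDl wE ev_sum_prod !cmap_snd_cpair.
  rewrite evZl evn vN evBr (evt (P Y)) ?FE// -!/(P _).
  have -> : cmap (sum_proj1 D N) (P Y) = cmap (sum_proj1 D N) Y.
    by congr Cplx; apply/val_inj; rewrite /= sum_proj1_id// subvsP.
  by rewrite (addrC ('i * _)) subrK ev_subl subrK.
rewrite -/(sum_prod _ _) /=.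
set u1 := cpair X1 _; set u2 := cpair X2 eta.
have wE : cmap fst (sum_prod u1 u2) = cmap vsval X1 + cmap vsval X2.
  by rewrite cmap_fst_sum_prod !cmap_fst_cpair.
have X2E' : cmap vsval X2 \in E' by apply/C10E.
have wX1 : cmap (sum_proj1 D N) (cmap fst (sum_prod u1 u2)) = X1.
  rewrite wE; case: X1 X2 {u1 u2 X2C X2E' wE} => x y [z w].
  by congr Cplx; rewrite /= sum_proj1_sum.
have w_E : cmap fst (sum_prod u1 u2) \in E.
  by rewrite wE memvD ?(FE _ (DF X1)) ?(E'E _ X2E').
(* For the converse inclusion it suffices to test against Y in E; there Y - P Y lies in E', so [eta]
   contributes nothing and [key] concludes. *)
apply: (mem_lagrangian lagL) => [|Y YE]; rewrite cmap_fst_expB.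
  exact: w_E.
rewrite cmap_snd_expB evDl ev_sum_prod !cmap_snd_cpair evZl etaA ?addr0.
  by have := key _ _ w_E YE; rewrite wX1.
by apply/C10E; rewrite vN Psub.
Qed.

Theorem proposition4p15 (R : realType) (n r s k : nat)
    (M : @smooth_manifold R (2 * n + r)%N)
    (L : forall p : M, {vspace cplx (TT R (tangent p))})
    (hL : lagrangian_subbundle L) (m : M)
    (hr : real_index (L m) = r) (hs : lag_order (L m) = s)
    (hk : lag_type (L m) = k) :
  exists (N : {vspace tangent m})
         (B : 'Hom(tangent m, 'Hom(tangent m, R^o)))
         (C : {vspace subvs_of N}) (J : 'End(subvs_of C)),
    [/\ (Delta_sp (L m) + N = fullv)%VS, (Delta_sp (L m) :&: N = 0)%VS,
        two_form B, almost_CR J &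
        [set u | u \in L m] =
        cmap (expB B) @`
          (cmap (TTmap (sum_iso (Delta_sp (L m)) N)) @`
             L_prod (L_i (omega_Delta (L m))) (L_CR J))].
Proof. exact: lagrangian_normal_form (hL.2 m). Qed.
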